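(* Assume (A1) and (A3). Let $\alpha<1$, let $\Theta=(\theta_1,\dots,\theta_J)\in\mathsf T^J$ be fixed and let $\kappa\le 0$. Then for every $\boldsymbol\lambda\in\mathcal S_J$ we have $\Psi_\alpha(\mu_{\boldsymbol\lambda,\Theta})<\infty$, and for every $\eta>0$ the sequence $(\boldsymbol\lambda_n)_{n\ge1}$ defined by an arbitrary $\boldsymbol\lambda_1\in\mathcal S_J$ and $\boldsymbol\lambda_{n+1}=\mathcal I^{\mathrm{mixt}}_\alpha(\boldsymbol\lambda_n)$ is well-defined (all normalising sums lie in $(0,\infty)$). If in addition $\boldsymbol\lambda_1\in\mathcal S_J^+$, $\eta\in(0,1]$, and the measures $K(\theta_1,\cdot),\dots,K(\theta_J,\cdot)$ are linearly independent, then: (i) $(\Psi_\alpha(\mu_{\boldsymbol\lambda_n,\Theta}))_{n\ge1}$ is nonincreasing; (ii) $(\boldsymbol\lambda_n)_{n\ge1}$ converges to some $\boldsymbol\lambda^\star\in\mathcal S_J$ which is a fixed point of $\mathcal I^{\mathrm{mixt}}_\alpha$; (iii) $\Psi_\alpha(\mu_{\boldsymbol\lambda^\star,\Theta})=\inf_{\boldsymbol\lambda'\in\mathcal S_J}\Psi_\alpha(\mu_{\boldsymbol\lambda',\Theta})$.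
   Context: Let $(\mathsf Y,\mathcal Y,\nu)$ be a measure space with $\nu$ $\sigma$-finite, and $(\mathsf T,\mathcal T)$ a measurable space. Let $k:\mathsf T\times\mathsf Y\to[0,\infty)$ be measurable with $\int_{\mathsf Y}k(\theta,y)\nu(dy)=1$ for all $\theta$, and $K(\theta,A)=\int_A k(\theta,y)\nu(dy)$. Let $p$ be a measurable positive function on $\mathsf Y$. For a probability measure $\mu$ on $\mathsf T$ write $\mu k(y)=\int_{\mathsf T}\mu(d\theta)k(\theta,y)$. For $\alpha\in\mathbb R$ let $f_0(u)=u-1-\log u$, $f_1(u)=1-u+u\log u$, and $f_\alpha(u)=\frac{1}{\alpha(\alpha-1)}[u^\alpha-1-\alpha(u-1)]$ for $\alpha\notin\{0,1\}$ ($u>0$); so $f_\alpha'(u)=\frac{u^{\alpha-1}-1}{\alpha-1}$ for $\alpha\neq1$. Define $\Psi_\alpha(\mu)=\int_{\mathsf Y}f_\alpha\big(\mu k(y)/p(y)\big)p(y)\nu(dy)$ and $b_{\mu,\alpha}(\theta)=\int_{\mathsf Y}k(\theta,y)f_\alpha'\big(\mu k(y)/p(y)\big)\nu(dy)$. Assumption (A1): $k(\theta,y)>0$ and $p(y)>0$ for all $(\theta,y)$, and $\int_{\mathsf Y}p\,d\nu<\infty$. Mixture setting: $\mathcal S_J=\{\boldsymbol\lambda\in\mathbb R^J:\lambda_j\ge0,\sum_j\lambda_j=1\}$, $\mathcal S_J^+=\{\boldsymbol\lambda\in\mathcal S_J:\lambda_j>0\ \forall j\}$, and for $\Theta=(\theta_1,\dots,\theta_J)\in\mathsf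 T^J$, $\mu_{\boldsymbol\lambda,\Theta}=\sum_{j=1}^J\lambda_j\delta_{\theta_j}$. Given $\eta>0$ and $\kappa$ with $(\alpha-1)\kappa\ge0$, let $\Gamma_\alpha(v)=[(\alpha-1)v+1]^{\eta/(1-\alpha)}$ and $\mathcal I^{\mathrm{mixt}}_\alpha(\boldsymbol\lambda)=\Big(\frac{\lambda_j\Gamma_\alpha(b_{\mu_{\boldsymbol\lambda,\Theta},\alpha}(\theta_j)+\kappa)}{\sum_{\ell=1}^J\lambda_\ell\Gamma_\alpha(b_{\mu_{\boldsymbol\lambda,\Theta},\alpha}(\theta_\ell)+\kappa)}\Big)_{1\le j\le J}$ (the Power Descent update on the mixture weights). Assumption (A3): (i) for all $y$, $\theta\mapsto k(\theta,y)$ is continuous (with $\mathsf T$ a metric space with Borel $\sigma$-field); (ii) $\int_{\mathsf Y}\max_{1\le j\le J}k(\theta_j,y)\cdot\max_{1\le j'\le J}\big(k(\theta_{j'},y)/p(y)\big)^{\alpha-1}\nu(dy)<\infty$; if $\alpha=0$, additionally $\int_{\mathsf Y}\max_{1\le j\le J}|\log(k(\theta_j,y)/p(y))|\,p(y)\nu(dy)<\infty$. *)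

(* Defs.v *)
From HB Require Import structures.
From mathcomp Require Import all_boot all_order all_algebra.
From mathcomp Require Import all_classical all_reals all_analysis.
Set Implicit Arguments. Unset Strict Implicit. Unset Printing Implicit Defensive.
Import Order.TTheory GRing.Theory Num.Theory.
Import numFieldNormedType.Exports.
Local Open Scope classical_set_scope.
Local Open Scope ring_scope.

Section Defs.
Variable R : realType.

Definition falpha (a u : R) : R :=
  if a == 0 then u - 1 - ln u
  else if a == 1 then 1 - u + u * ln u
  else (u `^ a - 1 - a * (u - 1)) / (a * (a - 1)).

(* f_alpha' for alpha <> 1 (the only case used: alpha < 1) *)
Definition dfalpha (a u : R) : R := (u `^ (a - 1) - 1) / (a - 1).

Definition Gamma_alpha (a eta v : R) : R := ((a - 1) * v + 1) `^ (eta / (1 - a)).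

Definition simplex (J : nat) (lam : 'I_J -> R) : Prop :=
  (forall j, 0 <= lam j) /\ \sum_(j < J) lam j = 1.
Definition simplex_pos (J : nat) (lam : 'I_J -> R) : Prop :=
  (forall j, 0 < lam j) /\ \sum_(j < J) lam j = 1.

Definition borel_sets (T : topologicalType) : set (set T) := <<s open >>.
Definition prod_sigma (T : topologicalType) (d : measure_display)
  (Y : measurableType d) : set (set (T * Y)) :=
  <<s [set X | exists A C, borel_sets A /\ measurable C /\ X = A `*` C] >>.
Definition jointly_measurable (T : topologicalType) (d : measure_display)
  (Y : measurableType d) (k : T -> Y -> R) : Prop :=
  forall B : set R, measurable B ->
    @prod_sigma T d Y [set z : T * Y | B (k z.1 z.2)].

Variables (d : measure_display) (Y : measurableType d) (T : Type).

Definition mixk (k : T -> Y -> R) (J : nat) (Th : 'I_J -> T)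
  (lam : 'I_J -> R) (y : Y) : R := \sum_(j < J) lam j * k (Th j) y.

Variable nu : {measure set Y -> \bar R}.

Definition Psi (k : T -> Y -> R) (p : Y -> R) (a : R) (J : nat)
  (Th : 'I_J -> T) (lam : 'I_J -> R) : \bar R :=
  (\int[nu]_y (falpha a (mixk k Th lam y / p y) * p y)%:E)%E.

Definition b_integrand (k : T -> Y -> R) (p : Y -> R) (a : R) (J : nat)
  (Th : 'I_J -> T) (lam : 'I_J -> R) (th : T) (y : Y) : R :=
  k th y * dfalpha a (mixk k Th lam y / p y).

Definition bmu (k : T -> Y -> R) (p : Y -> R) (a : R) (J : nat)
  (Th : 'I_J -> T) (lam : 'I_J -> R) (th : T) : R :=
  Rintegral nu setT (b_integrand k p a Th lam th).

Definition norm_sum (k : T -> Y -> R) (p : Y -> R) (a eta kappa : R) (J : nat)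
  (Th : 'I_J -> T) (lam : 'I_J -> R) : R :=
  \sum_(l < J) lam l * Gamma_alpha a eta (bmu k p a Th lam (Th l) + kappa).

Definition Imixt (k : T -> Y -> R) (p : Y -> R) (a eta kappa : R) (J : nat)
  (Th : 'I_J -> T) (lam : 'I_J -> R) : 'I_J -> R :=
  fun j => lam j * Gamma_alpha a eta (bmu k p a Th lam (Th j) + kappa)
           / norm_sum k p a eta kappa Th lam.

Definition Kmeas (k : T -> Y -> R) (th : T) (A : set Y) : \bar R :=
  (\int[nu]_(y in A) (k th y)%:E)%E.

Definition lin_indep_measures (k : T -> Y -> R) (J : nat) (Th : 'I_J -> T) : Prop :=
  forall c : 'I_J -> R,
    (forall A : set Y, measurable A ->
       (\sum_(j < J) (c j)%:E * Kmeas k (Th j) A)%E = 0%E) ->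
    forall j, c j = 0.

End Defs.

(* Main.v *)
Require Import Defs.
From HB Require Import structures.
From mathcomp Require Import all_boot all_order all_algebra.
From mathcomp Require Import all_classical all_reals all_analysis.
From mathcomp Require Import measurable_realfun ring lra.
Import Order.TTheory GRing.Theory Num.Theory.
Import numFieldNormedType.Exports.
Local Open Scope classical_set_scope.
Local Open Scope ring_scope.

(** Write w = mu k / p and G_j = int k_j w^(a-1), so that
    (a-1) b_j + 1 = G_j and the update multiplies lambda_j by
    g_j proportional to (G_j + (a-1) kappa)^(eta/(1-a)).  Jensen's inequality
    bounds Psi after any reweighting lambda_j g_j by
    Psi + sum_j lambda_j G_j h(g_j), where h is falpha plus an affine function,
    and Chebyshev's sum inequality makes the last sum nonpositive for the
    power weights, with equality only when g = 1 on the support: Psi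
    decreases, strictly off the fixed points.

    Limit points of the iterates are therefore fixed points, all with the same
    value of Psi.  A fixed point has constant G_j on its support, so by
    convexity it minimises Psi over the face of its support, uniquely by linear
    independence.  A limit point close to another one has a larger support,
    hence coincides with it: limit points are isolated and, the update being
    continuous at them, the iterates converge.  If G_j exceeded the common
    level at the limit for some j, then the positive weights lambda_{n,j} would
    eventually increase, so j would be in the support; thus the first-order
    optimality condition holds at the limit. *)

(** * Positivity, scaling and tangent identities for f_alpha *)

Section falpha_theory.
Context {R : realType}.
Implicit Types a s t u w : R.

Lemma lt_ln_subr1 u : 0 < u -> u != 1 -> ln u < u - 1.
Proof.
move=> u0 u1; have := @expR_gt1Dx R (ln u); rewrite ln_eq0// u1 => /(_ isT).
by rewrite lnK ?posrE//; lra.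
Qed.

Lemma le_ln_subr1 u : 0 < u -> ln u <= u - 1.
Proof.
move=> u0; have [->|u1] := eqVneq u 1; first by rewrite ln1 subrr.
exact/ltW/lt_ln_subr1.
Qed.

(** Three cases: the logarithm bound at a = 0; that bound with 1 + x < exp x for a < 0; strict
    weighted AM-GM for 0 < a < 1, where a (a - 1) is negative. *)
Lemma falpha_gt0 a u : a < 1 -> 0 < u -> u != 1 -> 0 < falpha a u.
Proof.
move=> a1 u0 u1; rewrite /falpha.
have [a0|a0] := eqVneq a 0; first by have := lt_ln_subr1 _ u0 u1; lra.
rewrite (lt_eqF a1).
have pE b : u `^ b = expR (b * ln u) by rewrite /powR (gt_eqF u0).
have lnu0 : ln u != 0 by rewrite ln_eq0.
have [alt0|agt0] := ltP a 0.
- rewrite divr_gt0//; last by rewrite nmulr_rgt0// subr_lt0.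
  have := @expR_gt1Dx R (a * ln u); rewrite mulf_neq0// => /(_ isT).
  rewrite -pE; have := lt_ln_subr1 _ u0 u1.
  by nra.
- have {a0 agt0}agt0 : 0 < a by rewrite lt_def a0.
  rewrite -mulrNN mulr_gt0//; last first.
    by rewrite oppr_gt0 invr_lt0 pmulr_rlt0// subr_lt0.
  (* The weighted arithmetic mean of u and 1. The logarithm bounds at u / m and 1 / m, averaged with
     weights a and 1 - a, have right-hand sides averaging to 0, whence a ln u < ln m. *)
  set m := a * u + (1 - a).
  have m0 : 0 < m by rewrite /m; nra.
  suff : u `^ a < m by rewrite /m; lra.
  have um1 : u / m != 1.
    apply: contra u1 => /eqP e; apply/eqP.
    have /eqP : u = m by rewrite -[u](divfK (lt0r_neq0 m0)) e mul1r.
    rewrite -subr_eq0 /m (_ : _ - _ = (1 - a) * (u - 1)); last by ring.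
    rewrite mulf_eq0 subr_eq0 (gt_eqF a1)/= => /eqP; lra.
  have h1 := lt_ln_subr1 _ (divr_gt0 u0 m0) um1.
  have h2 := le_ln_subr1 m^-1; rewrite invr_gt0 in h2; move/(_ m0) in h2.
  rewrite ln_div ?posrE// in h1; rewrite lnV ?posrE// in h2.
  rewrite pE -[ltRHS]lnK ?posrE// ltr_expR.
  have e : a * (u / m) + (1 - a) * m^-1 = 1.
    by rewrite /m; field; rewrite -/m gt_eqF.
  have : a * (ln u - ln m) + (1 - a) * (- ln m) <
      a * (u / m - 1) + (1 - a) * (m^-1 - 1) by nra.
  by rewrite (_ : (_ + _ * (_ - _)) = (a * (u / m) + (1 - a) * m^-1) - 1); [rewrite e; lra|ring].
Qed.

Lemma falpha1 a : a < 1 -> falpha a 1 = 0.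
Proof.
move=> a1; rewrite /falpha (lt_eqF a1) powR1 ln1.
by case: ifP => _; rewrite !subrr ?mulr0 ?subrr ?mul0r.
Qed.

Lemma falpha_ge0 a u : a < 1 -> 0 < u -> 0 <= falpha a u.
Proof.
move=> a1 u0; have [->|u1] := eqVneq u 1; first by rewrite falpha1.
exact/ltW/falpha_gt0.
Qed.

(* Up to a constant, u^a / (a (a - 1)), or - ln u when a = 0. *)
Definition halpha a u : R := falpha a u + (u - 1) / (a - 1).

Lemma halpha1 a : a < 1 -> halpha a 1 = 0.
Proof. by move=> a1; rewrite /halpha falpha1// subrr mul0r addr0. Qed.

Lemma powRB1 a u : 0 < u -> u `^ a = u `^ (a - 1) * u.
Proof.
move=> u0; rewrite -[X in _ * X]powRr1 ?ltW// -powRD ?subrK//.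
by rewrite (gt_eqF u0) implybT.
Qed.

(** Separates the factor t up to a term linear in t w and w; for two mixtures of mass 1 that term
    integrates to zero. *)
Lemma falphaM a t w : a < 1 -> 0 < t -> 0 < w ->
  falpha a (t * w) = falpha a w + w `^ a * halpha a t - (t * w - w) / (a - 1).
Proof.
move=> a1 t0 w0; rewrite /halpha /falpha.
have [->|a0] := eqVneq a 0.
  by rewrite powRr0 lnM ?posrE//; field.
rewrite (lt_eqF a1) powRM ?ltW//; field.
by rewrite a0 lt_eqF// subr_lt0.
Qed.

Lemma halphaM a s t : a < 1 -> 0 < s -> 0 < t ->
  halpha a (t * s) = halpha a s + s `^ a * halpha a t.
Proof.
move=> a1 s0 t0; rewrite {1 2}/halpha falphaM//.
by field; rewrite lt_eqF// subr_lt0.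
Qed.

(** Comes from [halphaM] at t = (t / s) s. The remainder is exact, so the sign of [falpha] gives
    convexity and its only zero the equality case. *)
Lemma halpha_tangent_gap a s t : a < 1 -> 0 < s -> 0 < t ->
  halpha a t = halpha a s + s `^ (a - 1) / (a - 1) * (t - s)
             + s `^ a * falpha a (t / s).
Proof.
move=> a1 s0 t0; rewrite -{1}[t](divfK (lt0r_neq0 s0)) (halphaM a s (t / s)) ?divr_gt0//.
rewrite /halpha (powRB1 a s)//; field.
by rewrite (gt_eqF s0) lt_eqF// subr_lt0.
Qed.

Lemma halpha_tangent a s t : a < 1 -> 0 < s -> 0 < t ->
  halpha a s + s `^ (a - 1) / (a - 1) * (t - s) <= halpha a t.
Proof.
move=> a1 s0 t0; rewrite (halpha_tangent_gap a s t)// lerDl.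
by rewrite mulr_ge0 ?powR_ge0// falpha_ge0// divr_gt0.
Qed.

(** The Bregman divergence of [falpha] is a rescaled [falpha], hence positive unless u = w;
    integrated, it yields strict convexity of [Psi]. *)
Lemma falpha_bregman a w u : a < 1 -> 0 < w -> 0 < u ->
  falpha a u = falpha a w + (w `^ (a - 1) - 1) / (a - 1) * (u - w)
             + w `^ a * falpha a (u / w).
Proof.
move=> a1 w0 u0; rewrite -{1}[u](divfK (lt0r_neq0 w0)) (falphaM a (u / w)) ?divr_gt0//.
rewrite /halpha (powRB1 a w)//; field.
by rewrite (gt_eqF w0) lt_eqF// subr_lt0.
Qed.

End falpha_theory.

(** * Compactness and convergence in the simplex *)

Section simplex_sequences.
Context {R : realType} {J : nat}.
Implicit Types (l z : 'I_J -> R) (u : nat -> 'I_J -> R).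

Lemma simplex_le1 l j : simplex l -> l j <= 1.
Proof.
by move=> [l0 l1]; rewrite -l1 (bigD1 j)//= lerDl sumr_ge0.
Qed.

Lemma simplex_exists_gt0 l : simplex l -> exists j, 0 < l j.
Proof.
move=> [l0 l1]; apply/not_existsP => h.
suff : \sum_(j < J) l j = 0 by rewrite l1 => /eqP; rewrite oner_eq0.
apply: big1 => j _; apply/eqP; rewrite eq_le l0 andbT leNgt.
exact/negP/h.
Qed.

Lemma simplex_sum_gt0 l (x : 'I_J -> R) : simplex l -> (forall j, 0 < x j) ->
  0 < \sum_(j < J) l j * x j.
Proof.
move=> sl x0; have [i li] := simplex_exists_gt0 _ sl.
rewrite (bigD1 i)//= ltr_wpDr ?mulr_gt0//.
by apply: sumr_ge0 => j _; apply: mulr_ge0; [exact: sl.1|exact/ltW].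
Qed.

Lemma cvg_sum_ord (f : 'I_J -> nat -> R) (s : 'I_J -> R) :
  (forall j, f j @ \oo --> s j) ->
  (fun n => \sum_(j < J) f j n) @ \oo --> \sum_(j < J) s j.
Proof.
move=> fs; apply: cvg_big => //; exact: add_continuous.
Qed.

(** An index map with i <= e i tends to infinity even if it is not increasing; limit points are
    encoded this way below. *)
Lemma cvg_subseq (v : nat -> R) (x : R) (e : nat -> nat) :
  (forall i, (i <= e i)%N) -> v @ \oo --> x -> (v \o e) @ \oo --> x.
Proof.
move=> ie vx; apply: cvg_comp vx => P [N _ NP].
by exists N => // i /= Ni; apply: NP; exact: leq_trans (ie i).
Qed.

Lemma simplex_subseq u : (forall n, simplex (u n)) ->
  exists z (e : nat -> nat), [/\ simplex z, forall i, (i <= e i)%N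
    & forall j, (fun i => u (e i) j) @ \oo --> z j].
Proof.
move=> su; pose v n : 'rV[R]_J := \row_j u n j.
pose K := [set w : 'rV[R]_J | forall i, `[0, 1]%classic (w ord0 i)].
have cK : compact K.
  by apply: (@rV_compact R J (fun=> `[0:R, 1:R]%classic)) => _; exact: segment_compact.
have vK n : K (v n).
  move=> i; rewrite /= in_itv/= mxE simplex_le1// andbT.
  by case: (su n).
have [x [Kx clx]] := cK (v @ \oo) _ (filterE _ vK).
(* The cluster property, tested on the tail from i and the ball of radius 1 / (i + 1), supplies e
   i. *)
have /choice[e eP] (i : nat) : exists n, (i <= n)%N /\
    forall j, `|x ord0 j - u n j| < i.+1%:R^-1.
  have [] := clx (v @` [set n | (i <= n)%N]) (ball x i.+1%:R^-1).
  - by exists i => // n /= ni; exists n.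
  - exact: nbhsx_ballx.
  move=> _ [[n /= ni <-] xv]; exists n; split => // j.
  by case: xv => _ /(_ ord0 j); rewrite /ball/= mxE.
have ez j : (fun i => u (e i) j) @ \oo --> x ord0 j.
  apply/cvgrPdist_lt => /= eps eps0.
  near=> i; apply: lt_trans ((eP i).2 j) _.
  near: i; exact: (near_infty_natSinv_lt (PosNum eps0)).
exists (x ord0), e; split=> //; last by move=> i; case: (eP i).
split=> [j|]; first by have := Kx j; rewrite /= in_itv/= => /andP[].
have := cvg_sum_ord _ _ ez; under eq_cvg do rewrite (su _).2.
by move=> /(cvg_unique (@Rhausdorff R)) /(_ (cvg_cst _)).
Unshelve. all: by end_near. Qed.

Lemma powR_cvg (f : nat -> R) (x r : R) : 0 < x -> f @ \oo --> x ->
  (fun n => f n `^ r) @ \oo --> x `^ r.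
Proof.
move=> x0 fx.
suff px : {for x, continuous (fun y => y `^ r)} by apply: (cvg_comp _ _ fx px).
apply: differentiable_continuous; apply/derivable1_diffP.
by apply: derivable_powR; rewrite in_itv/= x0.
Qed.

End simplex_sequences.

(** * Sum inequalities for normalised power weights *)

Section power_weights.
Context {R : realType}.

(** The first factor is ys (t^(1 - eta) - 1) + c (1 - t^(- eta)). As 0 < eta <= 1, both summands are
    nonnegative for t >= 1 and nonpositive for t < 1, like t^phi - 1. *)
Lemma power_monotone (t ys c eta phi : R) : 0 < t -> 0 < ys -> 0 <= c ->
  0 < eta -> eta <= 1 -> 0 < phi ->
  0 <= ((t * ys - c) * t `^ (- eta) - (ys - c)) * (t `^ phi - 1).
Proof.
move=> t0 ys0 c0 e0 e1 p0.
have tE : t * t `^ (- eta) = t `^ (1 - eta).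
  by rewrite -[X in X * _](powRr1 (ltW t0)) -powRD// (gt_eqF t0) implybT.
rewrite (_ : (t * ys - c) * _ - _ =
    ys * (t * t `^ (- eta) - 1) + c * (1 - t `^ (- eta))); last by ring.
rewrite tE.
have [t1|t1] := leP 1 t.
- have h r : 0 <= r -> 1 <= t `^ r.
    by move=> r0; rewrite -(powRr0 t) ler_powR.
  rewrite mulr_ge0//; last by rewrite subr_ge0 h// ltW.
  rewrite addr_ge0// mulr_ge0// ?subr_ge0 ?h ?subr_ge0//; first exact: ltW.
  by rewrite -(powRr0 t) ler_powR// oppr_le0 ltW.
- have t01 : 0 < t <= 1 by rewrite t0 ltW.
  have h r : 0 <= r -> t `^ r <= 1.
    by move=> r0; rewrite -(powRr0 t) ger_powR.
  rewrite -mulrNN mulr_ge0//; last by rewrite oppr_ge0 subr_le0 h// ltW.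
  rewrite opprD addr_ge0// -mulrN opprB mulr_ge0//.
  + exact: ltW.
  + by rewrite subr_ge0 h// subr_ge0.
  + by rewrite subr_ge0 -(powRr0 t) ger_powR// oppr_le0 ltW.
Qed.

Context {J : nat} (a eta c : R) (l x : 'I_J -> R).
Hypotheses (a1 : a < 1) (eta0 : 0 < eta) (eta1 : eta <= 1) (c0 : 0 <= c).
Hypotheses (sl : simplex l) (x0 : forall j, 0 < x j).

Let phi := eta / (1 - a).
Let S := \sum_(j < J) l j * (x j + c) `^ phi.
Let g j := (x j + c) `^ phi / S.

Let phi0 : 0 < phi. Proof. by rewrite divr_gt0// subr_gt0. Qed.
Let xc0 j : 0 < x j + c. Proof. by rewrite ltr_wpDr. Qed.
Let S0 : 0 < S.
Proof. by apply: simplex_sum_gt0 => // j; rewrite powR_gt0. Qed.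
Let g0 j : 0 < g j. Proof. by rewrite divr_gt0// powR_gt0. Qed.

Lemma power_weights_sum1 : \sum_(j < J) l j * g j = 1.
Proof.
under eq_bigr do rewrite mulrA.
by rewrite -mulr_suml divff// gt_eqF.
Qed.

(* Chebyshev's sum inequality: g j and x j * g j `^ (a - 1) are both
   nondecreasing functions of x j, and g has mean 1. *)
Lemma power_weights_chebyshev :
  0 <= \sum_(j < J) l j * (x j * g j `^ (a - 1) * (g j - 1)).
Proof.
(* The power mean of order phi of the x_j + c. Dividing by it absorbs the normaliser into g_j =
   t_j^phi, and phi (a - 1) = - eta brings x_j g_j^(a - 1) to the form of [power_monotone]. *)
pose ys := S `^ phi^-1.
have ys0 : 0 < ys by rewrite powR_gt0.
have SE : S = ys `^ phi.
  by rewrite -powRrM mulVf ?gt_eqF// powRr1// ltW.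
pose t j := (x j + c) / ys.
have t0 j : 0 < t j by rewrite divr_gt0.
have gE j : g j = t j `^ phi.
  rewrite powRM ?invr_ge0 ?ltW// /g SE -(powR_inv1 (ltW ys0)) powRAC.
  by rewrite powR_inv1 ?powR_ge0.
have xE j : x j * g j `^ (a - 1) = (t j * ys - c) * t j `^ (- eta).
  rewrite gE -powRrM /t divfK ?gt_eqF// addrK; congr (_ * _ `^ _).
  by rewrite /phi; field; rewrite subr_eq0 gt_eqF.
(* The constant ys - c is the value of (t ys - c) t^(- eta) at t = 1; subtracting it is free because
   g has mean 1. *)
have e : \sum_(j < J) l j * ((ys - c) * (g j - 1)) = 0.
  rewrite (eq_bigr (fun j => (ys - c) * (l j * g j - l j))); last by move=> j _; ring.
  by rewrite -mulr_sumr sumrB power_weights_sum1 sl.2 subrr mulr0.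
apply: le_trans (_ : \sum_(j < J) l j * ((ys - c) * (g j - 1)) <= _).
  by rewrite e.
apply: ler_sum => j _; rewrite ler_wpM2l ?sl.1// -subr_ge0 -mulrBl.
by rewrite xE gE power_monotone.
Qed.

(** The tangent at g_j evaluated at 1, where [halpha] vanishes. Chebyshev's inequality controls the
    first term; the second has a known sign. *)
Let halpha_gap j : halpha a (g j) =
  g j `^ (a - 1) * (g j - 1) / (a - 1) - g j `^ a * falpha a (g j)^-1.
Proof.
have := halpha_tangent_gap a (g j) 1 a1 (g0 j) ltr01.
rewrite halpha1// div1r => /esym/eqP; rewrite -addrA addr_eq0 => /eqP ->.
by field; rewrite subr_eq0 lt_eqF.
Qed.

Let halpha_sumE : \sum_(j < J) l j * x j * halpha a (g j) =
  (\sum_(j < J) l j * (x j * g j `^ (a - 1) * (g j - 1))) / (a - 1)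
  - \sum_(j < J) l j * x j * (g j `^ a * falpha a (g j)^-1).
Proof.
rewrite mulr_suml -sumrB; apply: eq_bigr => j _; rewrite halpha_gap; ring.
Qed.

Let gap_ge0 j : 0 <= l j * x j * (g j `^ a * falpha a (g j)^-1).
Proof.
rewrite mulr_ge0//; first by rewrite mulr_ge0 ?sl.1 ?ltW.
by rewrite mulr_ge0 ?powR_ge0// falpha_ge0// invr_gt0.
Qed.

Lemma power_weights_halpha_le0 :
  \sum_(j < J) l j * x j * halpha a (g j) <= 0.
Proof.
rewrite halpha_sumE subr_le0 (@le_trans _ _ 0)//; last exact: sumr_ge0.
by rewrite mulr_ge0_le0 ?power_weights_chebyshev// invr_le0 subr_le0 ltW.
Qed.

(** The nonnegative gap sum then equals the Chebyshev sum divided by a - 1 < 0, so every gap is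
    zero, and [falpha] vanishes only at 1. *)
Lemma power_weights_halpha_eq0 :
  \sum_(j < J) l j * x j * halpha a (g j) = 0 -> forall j, 0 < l j -> g j = 1.
Proof.
rewrite halpha_sumE => /eqP; rewrite subr_eq0 => /eqP e j lj.
have gap0 : \sum_(j < J) l j * x j * (g j `^ a * falpha a (g j)^-1) = 0.
  apply/eqP; rewrite eq_le (sumr_ge0 _ (fun j _ => gap_ge0 j)) andbT -e.
  by rewrite mulr_ge0_le0 ?power_weights_chebyshev// invr_le0 subr_le0 ltW.
have /(_ j isT)/eqP := psumr_eq0P (fun j _ => gap_ge0 j) gap0.
apply: contraTeq => gj1; rewrite gt_eqF// mulr_gt0//; first by rewrite mulr_gt0.
by rewrite mulr_gt0 ?powR_gt0// falpha_gt0 ?invr_gt0// invr_eq1.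
Qed.

End power_weights.

(** * Convergence of power descent for an abstract strictly convex function on the simplex *)

Section power_descent.
Context {R : realType} {J : nat}.
Variables (a eta c : R) (Psi : ('I_J -> R) -> R)
  (G : ('I_J -> R) -> 'I_J -> R).
Hypotheses (a1 : a < 1) (eta0 : 0 < eta) (c0 : 0 <= c).
Hypothesis G_gt0 : forall l, simplex l -> forall j, 0 < G l j.

Definition power_mass (l : 'I_J -> R) : R :=
  \sum_(i < J) l i * (G l i + c) `^ (eta / (1 - a)).

(** [Imixt] with [G l j] for (a - 1) b_j + 1 and [c] for (a - 1) kappa. *)
Definition power_update (l : 'I_J -> R) (j : 'I_J) : R :=
  l j * (G l j + c) `^ (eta / (1 - a)) / power_mass l.

Let gt0c l j : simplex l -> 0 < G l j + c.
Proof. by move=> sl; rewrite ltr_wpDr// G_gt0. Qed.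

Lemma power_mass_gt0 l : simplex l -> 0 < power_mass l.
Proof.
by move=> sl; apply: simplex_sum_gt0 => // j; rewrite powR_gt0 ?gt0c.
Qed.

Lemma power_update_simplex l : simplex l -> simplex (power_update l).
Proof.
move=> sl; split=> [j|].
  by rewrite !mulr_ge0 ?sl.1 ?powR_ge0// invr_ge0 ltW// power_mass_gt0.
by rewrite -mulr_suml divff// gt_eqF// power_mass_gt0.
Qed.

Lemma power_update_gt0 l j : simplex l -> 0 < l j -> 0 < power_update l j.
Proof.
by move=> sl lj; rewrite !mulr_gt0 ?powR_gt0 ?gt0c// invr_gt0 power_mass_gt0.
Qed.

Hypothesis G_bounded : exists M, forall l j, simplex l -> G l j <= M.
Hypothesis G_continuous : forall u z, (forall n, simplex (u n)) -> simplex z ->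
  (forall j, (fun n => u n j) @ \oo --> z j) ->
  forall j, (fun n => G (u n) j) @ \oo --> G z j.

Let factor l j := (G l j + c) `^ (eta / (1 - a)) / power_mass l.

Let factorE l : power_update l = fun j => l j * factor l j.
Proof. by apply/funext => j; rewrite /factor mulrA. Qed.

Let factor_continuous u z : (forall n, simplex (u n)) -> simplex z ->
  (forall j, (fun n => u n j) @ \oo --> z j) ->
  forall j, (fun n => factor (u n) j) @ \oo --> factor z j.
Proof.
move=> su sz uz j.
have h i : (fun n => (G (u n) i + c) `^ (eta / (1 - a))) @ \oo -->
    (G z i + c) `^ (eta / (1 - a)).
  apply: powR_cvg; first exact: gt0c.
  by apply: cvgD; [exact: G_continuous|exact: cvg_cst].
apply: cvgM; first exact: h.
apply: cvgV; first by rewrite gt_eqF// power_mass_gt0.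
by apply: cvg_sum_ord => i; apply: cvgM; [exact: uz|exact: h].
Qed.

Lemma power_update_continuous u z : (forall n, simplex (u n)) -> simplex z ->
  (forall j, (fun n => u n j) @ \oo --> z j) ->
  forall j, (fun n => power_update (u n) j) @ \oo --> power_update z j.
Proof.
move=> su sz uz j; rewrite factorE; under eq_cvg do rewrite factorE.
by apply: cvgM; [exact: uz|exact: factor_continuous].
Qed.

Hypothesis eta1 : eta <= 1.
Hypothesis Psi_ge0 : forall l, simplex l -> 0 <= Psi l.
(** [G z] divided by a - 1 acts as the gradient of [Psi] at z along the simplex. *)
Hypothesis Psi_tangent : forall l z, simplex l -> simplex z ->
  Psi z + (\sum_(j < J) (l j - z j) * G z j) / (a - 1) <= Psi l.
Hypothesis Psi_tangent_lt : forall l z, simplex l -> simplex z -> l != z ->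
  Psi z + (\sum_(j < J) (l j - z j) * G z j) / (a - 1) < Psi l.
Hypothesis Psi_scale : forall (l g : 'I_J -> R), simplex l -> (forall j, 0 < g j) ->
  \sum_(j < J) l j * g j = 1 ->
  Psi (fun j => l j * g j) <= Psi l + \sum_(j < J) l j * G l j * halpha a (g j).

Let Psi_factor l : simplex l -> Psi (power_update l) <=
  Psi l + \sum_(j < J) l j * G l j * halpha a (factor l j).
Proof.
move=> sl; rewrite factorE; apply: Psi_scale => // [j|].
  by rewrite divr_gt0 ?power_mass_gt0// powR_gt0// gt0c.
by apply: power_weights_sum1 => //; exact: G_gt0.
Qed.

Lemma power_update_descent l : simplex l -> Psi (power_update l) <= Psi l.
Proof.
move=> sl; apply: le_trans (Psi_factor _ sl) _; rewrite gerDl.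
by apply: power_weights_halpha_le0 => //; exact: G_gt0.
Qed.

Lemma power_update_stationary l : simplex l -> Psi l <= Psi (power_update l) ->
  power_update l = l.
Proof.
move=> sl /le_trans/(_ (Psi_factor _ sl)); rewrite lerDl => h.
have {}h : \sum_(j < J) l j * G l j * halpha a (factor l j) = 0.
  apply/eqP; rewrite eq_le h andbT.
  by apply: power_weights_halpha_le0 => //; exact: G_gt0.
have f1 := power_weights_halpha_eq0 _ _ _ _ _ a1 eta0 eta1 c0 sl (G_gt0 _ sl) h.
rewrite factorE; apply/funext => j.
have [lj|] := ltP 0 (l j); first by rewrite [factor _ _](f1 j lj) mulr1.
by move=> lj; rewrite (_ : l j = 0) ?mul0r//; apply/eqP; rewrite eq_le lj sl.1.
Qed.

Let fixpoint_factor l k : power_update l = l -> 0 < l k -> factor l k = 1.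
Proof.
move=> fl lk; have := congr1 (fun f => f k) fl; rewrite factorE /=.
by rewrite -[RHS]mulr1 => /(mulfI (lt0r_neq0 lk)).
Qed.

(** All factors on the support are 1 and share one normaliser, and the power is injective. *)
Lemma fixpoint_level l i j : simplex l -> power_update l = l ->
  0 < l i -> 0 < l j -> G l i = G l j.
Proof.
move=> sl fl /(fixpoint_factor _ _ fl) fi /(fixpoint_factor _ _ fl).
rewrite -fi => /esym/mulIf; rewrite invr_eq0 gt_eqF ?power_mass_gt0// => /(_ isT).
move=> /powR_injective e; apply: (addIr c); apply: e; rewrite ?nnegrE ?ltW ?gt0c//.
by rewrite divr_gt0// subr_gt0.
Qed.

(** Makes the linear term of the tangent inequality vanish on the face of the support of l. *)
Lemma fixpoint_mean l i : simplex l -> power_update l = l -> 0 < l i ->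
  forall z, simplex z -> (forall j, 0 < z j -> 0 < l j) ->
  \sum_(j < J) z j * G l j = G l i.
Proof.
move=> sl fl li z sz zl.
rewrite -[RHS]mul1r -sz.2 mulr_suml; apply: eq_bigr => j _.
have [zj|] := ltP 0 (z j); first by rewrite (fixpoint_level _ j i sl fl (zl _ zj) li).
by move=> zj; rewrite (_ : z j = 0) ?mul0r//; apply/eqP; rewrite eq_le zj sz.1.
Qed.

(** The tangent inequality at z with bounded scores; exchanging l and z makes the bound
    two-sided. *)
Lemma Psi_lipschitz : exists M, 0 <= M /\ forall l z, simplex l -> simplex z ->
  Psi z - Psi l <= M * \sum_(j < J) `|l j - z j|.
Proof.
have [M GM] := G_bounded; exists (`|M| / (1 - a)).
split; first by rewrite divr_ge0// subr_ge0 ltW.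
move=> l z sl sz; have := Psi_tangent _ _ sl sz.
rewrite -lerBrDl -[a - 1]opprB invrN mulrN lerNl opprB => /le_trans; apply.
rewrite mulrAC ler_wpM2r//; first by rewrite invr_ge0 subr_ge0 ltW.
rewrite mulr_sumr; apply: ler_sum => j _; rewrite mulrC; apply: le_trans (ler_norm _) _.
rewrite normrM ler_wpM2r// gtr0_norm ?G_gt0//.
exact: le_trans (GM _ _ sz) (ler_norm _).
Qed.

Lemma Psi_continuous u z : (forall n, simplex (u n)) -> simplex z ->
  (forall j, (fun n => u n j) @ \oo --> z j) ->
  (fun n => Psi (u n)) @ \oo --> Psi z.
Proof.
move=> su sz uz; have [M [M0 ML]] := Psi_lipschitz.
pose d n := M * \sum_(j < J) `|u n j - z j|.
have d0 : d @ \oo --> (0 : R).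
  rewrite (_ : 0 = M * \sum_(j < J) `|z j - z j|); last first.
    by rewrite big1 ?mulr0// => j _; rewrite subrr normr0.
  apply: cvgM; first exact: cvg_cst.
  apply: cvg_sum_ord => j; apply: cvg_norm.
  by apply: cvgB; [exact: uz|exact: cvg_cst].
apply: (@squeeze_cvgr _ _ _ _ (fun n => Psi z - d n) (fun n => Psi z + d n)).
- near=> n; rewrite lerBlDr -lerBlDl ML//=.
  rewrite -lerBlDl (le_trans (ML _ _ sz (su n)))//.
  by under eq_bigr do rewrite distrC.
- by rewrite -[X in _ --> X]subr0; apply: cvgB => //; exact: cvg_cst.
- by rewrite -[X in _ --> X]addr0; apply: cvgD => //; exact: cvg_cst.
Unshelve. all: by end_near. Qed.

Variable lam : nat -> 'I_J -> R.
Hypothesis lam0 : simplex_pos (lam 0%N).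
Hypothesis lamS : forall n, lam n.+1 = power_update (lam n).

Lemma iterates_simplex n : simplex (lam n).
Proof.
elim: n => [|n ih]; last by rewrite lamS; exact: power_update_simplex.
by case: lam0 => l0 l1; split => // j; exact/ltW.
Qed.

Lemma iterates_gt0 n j : 0 < lam n j.
Proof.
elim: n => [|n ih]; first by case: lam0.
by rewrite lamS power_update_gt0//; exact: iterates_simplex.
Qed.

Definition limit_point z := simplex z /\ exists e : nat -> nat,
  (forall i, (i <= e i)%N) /\ forall j, (fun i => lam (e i) j) @ \oo --> z j.

(** [Psi] is nonincreasing along the iterates and bounded below, hence convergent; its continuity
    transfers the limit. *)
Lemma limit_point_level : exists V, forall z, limit_point z -> Psi z = V.
Proof.
have /cvg_ex[/= V lV] : cvgn (fun n => Psi (lam n)).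
  apply: nonincreasing_is_cvgn.
    apply/nonincreasing_seqP => n; rewrite lamS power_update_descent//.
    exact: iterates_simplex.
  by exists 0 => _ [n _ <-]; exact/Psi_ge0/iterates_simplex.
exists V => z [sz [e [ie ez]]].
apply: (cvg_unique (@Rhausdorff R)) (cvg_subseq _ _ _ ie lV).
by apply: Psi_continuous => // n; exact: iterates_simplex.
Qed.

Lemma limit_point_update z : limit_point z -> limit_point (power_update z).
Proof.
move=> [sz [e [ie ez]]]; split; first exact: power_update_simplex.
exists (fun i => (e i).+1); split; first by move=> i; exact: leq_trans (ie i) _.
move=> j; under eq_cvg do rewrite lamS.
by apply: power_update_continuous => // n; exact: iterates_simplex.
Qed.

(** The update of z is a limit point too, so [Psi] does not decrease at z and z is stationary. *)
Lemma limit_point_fixpoint z : limit_point z -> power_update z = z.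
Proof.
move=> lz; have [V VE] := limit_point_level.
apply: power_update_stationary; first by case: lz.
by rewrite (VE _ lz) VE//; exact: limit_point_update.
Qed.

(* A limit point charging every index charged by z minimises Psi over a face
   containing z, while both have the same value; strict convexity concludes. *)
Lemma limit_point_isolated z z' : limit_point z -> limit_point z' ->
  (forall j, 0 < z j -> 0 < z' j) -> z = z'.
Proof.
move=> lz lz' zz'; have [V VE] := limit_point_level.
have [sz sz'] := (lz.1, lz'.1).
apply/eqP; rewrite -[_ == _]negbK; apply/negP => neq.
have := Psi_tangent_lt _ _ sz sz' neq.
rewrite (VE _ lz) (VE _ lz').
have [i zi] := simplex_exists_gt0 _ sz'.
have fz' := limit_point_fixpoint _ lz'.
under eq_bigr do rewrite mulrBl.
rewrite sumrB (fixpoint_mean _ _ sz' fz' zi _ sz zz').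
by rewrite (fixpoint_mean _ _ sz' fz' zi _ sz')// subrr mul0r addr0 ltxx.
Qed.

Lemma iterates_cvg : exists z, limit_point z /\
  forall j, (fun n => lam n j) @ \oo --> z j.
Proof.
have [z [e [sz ie ez]]] := simplex_subseq _ iterates_simplex.
have lz : limit_point z by split => //; exists e.
have close (u : nat -> 'I_J -> R) (r : R) : 0 < r ->
    (forall j, (fun n => u n j) @ \oo --> z j) ->
    \forall n \near \oo, forall j, `|z j - u n j| < r.
  by move=> r0 uz; apply: filter_forall => j; exact: cvgr_dist_lt.
(* Radii below all positive weights of z suffice: any tolerance dominates some 1 / (m + 1) of this
   kind. *)
suff main (r : R) : 0 < r -> (forall j, 0 < z j -> r < z j) ->
    \forall n \near \oo, forall j, `|z j - lam n j| < r.
  exists z; split => // j; apply/cvgrPdist_lt => /= eps eps0.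
  have [m [me mz]] : exists m : nat, m.+1%:R^-1 < eps /\
      forall i, 0 < z i -> m.+1%:R^-1 < z i.
    apply: (@filter_ex _ \oo); near=> m; split.
      by near: m; exact: (near_infty_natSinv_lt (PosNum eps0)).
    near: m; apply: filter_forall => i.
    have [zi|zi] := ltP 0 (z i); last by apply: nearW => m.
    by apply: filterS (near_infty_natSinv_lt (PosNum zi)).
  have := main _ _ mz; rewrite invr_gt0 ltr0n => /(_ isT).
  by apply: filterS => n /(_ j) /lt_trans; apply.
move=> r0 rz; pose near_z n := forall j, `|z j - lam n j| < r.
(* Otherwise the iterates leave the r-neighbourhood of z at arbitrarily late times f N; a limit
   point along these exits gives the contradiction. *)
have [N stable] : exists N, forall n, (N <= n)%N -> near_z n -> near_z n.+1.
  apply: contrapT => /forallNP h.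
  have /choice[f fP] N : exists n, [/\ (N <= n)%N, near_z n & ~ near_z n.+1].
    apply: contrapT => /forallNP hN; apply: (h N) => n Nn nn.
    by apply: contrapT => nn1; exact: (hN n).
  have [z' [e' [sz' ie' ez']]] := simplex_subseq (lam \o f) (fun n => iterates_simplex (f n)).
  have lz' : limit_point z'.
    split => //; exists (f \o e'); split => // i /=.
    by apply: leq_trans (ie' i) _; case: (fP (e' i)).
  have zz' : z = z'.
    apply: limit_point_isolated => // j zj.
    (* Since r < z j, this bound keeps z' j positive. *)
    have : `|z j - z' j| <= r.
      have /cvg_norm : (fun i => z j - lam (f (e' i)) j) @ \oo --> z j - z' j.
        by apply: cvgB; [exact: cvg_cst|exact: ez'].
      move=> /cvgr_to_le; apply; near=> i.
      by case: (fP (e' i)) => _ /(_ j) /ltW.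
    by have := rz _ zj; rewrite ler_norml; lra.
  (* The update fixes z, so the successors of the exits also tend to z, although none of them is
     near z. *)
  have /(close _ _ r0) : forall j, (fun i => lam (f (e' i)).+1 j) @ \oo --> z j.
    move=> j; rewrite zz' -(limit_point_fixpoint _ lz').
    under eq_cvg do rewrite lamS.
    by apply: power_update_continuous => // n; exact: iterates_simplex.
  by move=> /filter_ex[i]; case: (fP (e' i)).
have [i [Ni ni]] : exists i, (N <= i)%N /\ near_z (e i).
  apply: (@filter_ex _ \oo); near=> i; split.
    by near: i; exact: nbhs_infty_ge.
  by near: i; exact: (close (lam \o e)).
exists (e i) => // n /= /subnKC <-.
elim: (n - e i)%N => [|k ih]; first by rewrite addn0.
rewrite addnS; apply: stable ih.
by rewrite (leq_trans Ni)// (leq_trans (ie i))// leq_addr.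
Unshelve. all: by end_near. Qed.

Lemma limit_optimal z : simplex z -> power_update z = z ->
  (forall j, (fun n => lam n j) @ \oo --> z j) ->
  forall l, simplex l -> Psi z <= Psi l.
Proof.
move=> sz fz lz l sl; have [i zi] := simplex_exists_gt0 _ sz.
(* With no score above the support level, the linear term of the tangent inequality at z is
   nonnegative, as a - 1 < 0. *)
suff Gle j : G z j <= G z i.
  apply: le_trans (Psi_tangent _ _ sl sz); rewrite lerDl.
  rewrite -mulrNN mulr_ge0//; last first.
    by rewrite oppr_ge0 invr_le0 subr_le0 ltW.
  under eq_bigr do rewrite mulrBl.
  rewrite sumrB (fixpoint_mean _ _ sz fz zi _ sz)// opprB subr_ge0.
  rewrite -[leRHS]mul1r -sl.2 mulr_suml; apply: ler_sum => j _.
  by rewrite ler_wpM2l ?sl.1.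
rewrite leNgt; apply/negP => Gij.
(* Index i has factor 1 and factors increase with the score; by continuity the factor of j
   eventually exceeds 1 along the iterates. *)
have f1 : 1 < factor z j.
  rewrite -(fixpoint_factor _ _ fz zi) ltr_pM2r ?invr_gt0 ?power_mass_gt0//.
  rewrite gt0_ltr_powR ?nnegrE ?ltrD2r ?ltW ?gt0c//.
  by rewrite divr_gt0// subr_gt0.
have [N _ NP] := cvgr_gt _ (factor_continuous _ _ iterates_simplex sz lz j) _ f1.
have inc n : (N <= n)%N -> lam N j <= lam n j.
  move=> /subnKC <-; elim: (n - N)%N => [|k ih]; first by rewrite addn0.
  rewrite addnS lamS factorE (le_trans ih)// ler_peMr ?ltW ?iterates_gt0//.
  by apply: NP; rewrite /= leq_addr.
(* The positive weight at time N bounds all later ones from below, hence also their limit. *)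
have zj : 0 < z j.
  apply: lt_le_trans (iterates_gt0 N j) _.
  by apply: (cvgr_to_ge (lz j)); exists N.
by move: Gij; rewrite (fixpoint_level _ _ _ sz fz zi zj) ltxx.
Qed.

Lemma power_descent_cvg : exists z, [/\ simplex z,
  forall j, (fun n => lam n j) @ \oo --> z j, power_update z = z
  & forall l, simplex l -> Psi z <= Psi l].
Proof.
have [z [lz cz]] := iterates_cvg.
have [sz fz] := (lz.1, limit_point_fixpoint _ lz).
by exists z; split => //; exact: limit_optimal.
Qed.

End power_descent.

(** * Integrability and measurability of real-valued functions *)

Section real_integrals.
Context {R : realType} {d : measure_display} {Y : measurableType d}.
Variable nu : {measure set Y -> \bar R}.
Implicit Types (f g : Y -> R) (D : set Y).

Lemma integrable_addr D f g : measurable D ->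
  nu.-integrable D (EFin \o f) -> nu.-integrable D (EFin \o g) ->
  nu.-integrable D (EFin \o (fun y => f y + g y)).
Proof. by move=> mD fi gi; exact: (integrableD mD fi gi). Qed.

Lemma integrable_subr D f g : measurable D ->
  nu.-integrable D (EFin \o f) -> nu.-integrable D (EFin \o g) ->
  nu.-integrable D (EFin \o (fun y => f y - g y)).
Proof. by move=> mD fi gi; exact: (integrableB mD fi gi). Qed.

Lemma integrable_scaler D (r : R) f : measurable D ->
  nu.-integrable D (EFin \o f) ->
  nu.-integrable D (EFin \o (fun y => r * f y)).
Proof. by move=> mD fi; exact: (integrableZl mD r fi). Qed.

Lemma integrable_sumr D (I : finType) (f : I -> Y -> R) : measurable D ->
  (forall i, nu.-integrable D (EFin \o f i)) ->
  nu.-integrable D (EFin \o (fun y => \sum_i f i y)).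
Proof.
move=> mD fi; rewrite (_ : _ \o _ = fun y => (\sum_i (f i y)%:E)%E).
  by apply: integrable_sum => // i _; exact: fi.
by apply/funext => y; rewrite /= sumEFin.
Qed.

Lemma Rintegral_sumr D (I : finType) (c : I -> R) (f : I -> Y -> R) :
  measurable D -> (forall i, nu.-integrable D (EFin \o f i)) ->
  \int[nu]_(y in D) (\sum_i c i * f i y) = \sum_i c i * \int[nu]_(y in D) f i y.
Proof.
move=> mD fi; suff h (s : seq I) :
    nu.-integrable D (EFin \o (fun y => \sum_(i <- s) c i * f i y)) /\
    \int[nu]_(y in D) (\sum_(i <- s) c i * f i y) =
    \sum_(i <- s) c i * \int[nu]_(y in D) f i y by case: (h (index_enum I)).
elim: s => [|i s [ih1 ih2]].
  under eq_Rintegral do rewrite big_nil.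
  rewrite big_nil Rintegral_cst// mul0r; split => //.
  under eq_fun do rewrite big_nil; exact: integrable0.
under eq_Rintegral do rewrite big_cons.
have ici := integrable_scaler _ (c i) _ mD (fi i).
split.
  under eq_fun do rewrite big_cons; exact: integrable_addr.
by rewrite big_cons RintegralD// RintegralZl// ih2.
Qed.

Lemma ge0_integrable f : measurable_fun setT f -> (forall y, 0 <= f y) ->
  (\int[nu]_y (f y)%:E < +oo)%E -> nu.-integrable setT (EFin \o f).
Proof.
move=> mf f0 foo; apply/integrableP; split; first exact/measurable_EFinP.
by under eq_integral => y _ do rewrite gee0_abs ?lee_fin//.
Qed.

Lemma le_integrabler f g : measurable_fun setT f ->
  (forall y, 0 <= f y <= g y) -> nu.-integrable setT (EFin \o g) ->
  nu.-integrable setT (EFin \o f).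
Proof.
move=> mf fg; apply: le_integrable => //; first exact/measurable_EFinP.
move=> y _ /=; have /andP[f0 fgy] := fg y.
by rewrite lee_fin !ger0_norm// (le_trans f0).
Qed.

Lemma Rintegral_eq0_ae f : nu.-integrable setT (EFin \o f) ->
  (forall y, 0 <= f y) -> \int[nu]_y f y = 0 ->
  ae_eq nu setT (EFin \o f) (cst 0%E).
Proof.
move=> fi f0 If0; have mf := measurable_int _ fi.
apply/(ae_eq_integral_abs nu measurableT mf).
under eq_integral => y _ do rewrite gee0_abs ?lee_fin//.
rewrite -[LHS]fineK; first by rewrite -[fine _]/(\int[nu]_y f y) If0.
exact: integrable_fin_num.
Qed.

Lemma measurable_sum_fin (I : finType) (f : I -> Y -> R) :
  (forall i, measurable_fun setT (f i)) ->
  measurable_fun setT (fun y => \sum_i f i y).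
Proof.
move=> mf; elim: (index_enum I) => [|i s ih].
  by under eq_fun do rewrite big_nil; exact: measurable_cst.
by under eq_fun do rewrite big_cons; exact: measurable_funD.
Qed.

Lemma measurable_bigmax_fin (I : finType) (f : I -> Y -> R) :
  (forall i, measurable_fun setT (f i)) ->
  measurable_fun setT (fun y => \big[Num.max/0]_i f i y).
Proof.
move=> mf; elim: (index_enum I) => [|i s ih].
  by under eq_fun do rewrite big_nil; exact: measurable_cst.
by under eq_fun do rewrite big_cons; exact: measurable_maxr.
Qed.

End real_integrals.

(** The sets whose section at t is measurable form a sigma-algebra containing the measurable
    rectangles. *)
Lemma jointly_measurable_section (R : realType) (T : topologicalType)
    (d : measure_display) (Y : measurableType d) (k : T -> Y -> R) (t : T) :
  jointly_measurable k -> measurable_fun setT (k t).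
Proof.
move=> mk _ B mB; rewrite setTI.
suff: @prod_sigma T d Y `<=` [set X | measurable [set y | X (t, y)]].
  by move=> /(_ _ (mk B mB)).
apply: smallest_sub; first split => /=.
- by rewrite (_ : [set _ | _] = set0).
- move=> A mA; rewrite (_ : [set _ | _] = ~` [set y | A (t, y)]).
    exact: measurableC.
  by apply/seteqP; split => y //= [].
- by move=> A mA; exact: (bigcupT_measurable (fun n => [set y | A n (t, y)])).
- move=> _ [A [C [_ [mC ->]]]] /=.
  have [At|At] := pselect (A t).
    by rewrite (_ : [set _ | _] = C)//; apply/seteqP; split => y //= [].
  by rewrite (_ : [set _ | _] = set0)//; apply/seteqP; split => y //= [].
Qed.

(** * Scores, convexity and Jensen bound for the mixture divergence *)

Section mixture_divergence.
Context {R : realType} {d : measure_display} {Y : measurableType d}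
  {T : Type} {J : nat}.
Variables (nu : {measure set Y -> \bar R}) (k : T -> Y -> R) (p : Y -> R)
  (a : R) (Th : 'I_J -> T).
Hypothesis a1 : a < 1.
Hypothesis mk : forall j, measurable_fun setT (k (Th j)).
Hypothesis k1 : forall j, (\int[nu]_y (k (Th j) y)%:E = 1)%E.
Hypothesis mp : measurable_fun setT p.
Hypothesis k0 : forall j y, 0 < k (Th j) y.
Hypothesis p0 : forall y, 0 < p y.
Hypothesis p_fin : (\int[nu]_y (p y)%:E < +oo)%E.
Hypothesis dom_fin : (\int[nu]_y ((\big[Num.max/0]_(j < J) k (Th j) y)
  * (\big[Num.max/0]_(j' < J) (k (Th j') y / p y) `^ (a - 1)))%:E < +oo)%E.
Hypothesis ln_fin : a = 0 ->
  (\int[nu]_y ((\big[Num.max/0]_(j < J) `|ln (k (Th j) y / p y)|) * p y)%:E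
     < +oo)%E.

Implicit Types (l z : 'I_J -> R) (y : Y) (j : 'I_J).

Definition mix_ratio l y : R := mixk k Th l y / p y.

Definition mix_score l j : R :=
  \int[nu]_y (k (Th j) y * mix_ratio l y `^ (a - 1)).

(** The real-valued form of [Psi]; [mix_divE] identifies them on the simplex. *)
Definition mix_div l : R := \int[nu]_y (falpha a (mix_ratio l y) * p y).

Lemma mix_ratioK l y : mix_ratio l y * p y = mixk k Th l y.
Proof. by rewrite /mix_ratio divfK// gt_eqF. Qed.

Lemma mix_ratio_gt0 l y : simplex l -> 0 < mix_ratio l y.
Proof. by move=> sl; rewrite divr_gt0//; apply: simplex_sum_gt0. Qed.

(** An average is at least one of its terms. As a - 1 < 0, this bounds the power w^(a - 1) by the
    largest one among the components. *)
Lemma mix_ratio_ge l y : simplex l ->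
  exists j, k (Th j) y / p y <= mix_ratio l y.
Proof.
move=> sl; apply/not_existsP => h.
have : 0 < \sum_(j < J) l j * (k (Th j) y / p y - mix_ratio l y).
  apply: simplex_sum_gt0 => // j; rewrite subr_gt0 ltNge; exact/negP/h.
under eq_bigr do rewrite mulrBr mulrA.
by rewrite sumrB -!mulr_suml sl.2 mul1r subrr ltxx.
Qed.

Lemma measurable_mix_ratio l : measurable_fun setT (mix_ratio l).
Proof.
apply: measurable_funM.
  by apply: measurable_sum_fin => j; exact: measurable_funM.
under eq_fun do rewrite -powR_inv1 ?ltW//.
exact: (measurableT_comp (measurable_powR _)).
Qed.

Lemma measurable_density_ratio j :
  measurable_fun setT (fun y => k (Th j) y / p y).
Proof.
apply: measurable_funM => //.
under eq_fun do rewrite -powR_inv1 ?ltW//.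
exact: (measurableT_comp (measurable_powR _)).
Qed.

Lemma integrable_density j : nu.-integrable setT (EFin \o k (Th j)).
Proof.
apply: ge0_integrable => //; first by move=> y; exact/ltW.
by rewrite k1 ltry.
Qed.

Lemma Rintegral_density j : \int[nu]_y k (Th j) y = 1.
Proof. by rewrite /Rintegral k1. Qed.

Lemma integrable_target : nu.-integrable setT (EFin \o p).
Proof. by apply: ge0_integrable => // y; exact/ltW. Qed.

Lemma integrable_mixk (c : 'I_J -> R) :
  nu.-integrable setT (EFin \o (fun y => \sum_(j < J) c j * k (Th j) y)).
Proof.
apply: integrable_sumr => // j; apply: integrable_scaler => //.
exact: integrable_density.
Qed.

Lemma Rintegral_mixk (c : 'I_J -> R) :
  \int[nu]_y (\sum_(j < J) c j * k (Th j) y) = \sum_(j < J) c j.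
Proof.
rewrite Rintegral_sumr//; last exact: integrable_density.
by apply: eq_bigr => j _; rewrite Rintegral_density mulr1.
Qed.

(** A bound on the score integrands uniform in the weights, used for integrability, bounded scores
    and dominated convergence. *)
Let dom y := (\big[Num.max/0]_(j < J) k (Th j) y)
  * (\big[Num.max/0]_(j' < J) (k (Th j') y / p y) `^ (a - 1)).

Let integrable_dom : nu.-integrable setT (EFin \o dom).
Proof.
apply: ge0_integrable => // [|y]; last by rewrite mulr_ge0// bigmax_ge_id.
apply: measurable_funM; apply: measurable_bigmax_fin => // j.
exact: (measurableT_comp (measurable_powR _) (measurable_density_ratio j)).
Qed.

Let score_le_dom l j y : simplex l ->
  0 <= k (Th j) y * mix_ratio l y `^ (a - 1) <= dom y.
Proof.
move=> sl; apply/andP; split.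
  by rewrite mulr_ge0 ?powR_ge0// ltW.
rewrite /dom ler_pM ?powR_ge0//; first exact/ltW.
  exact: (le_bigmax 0 (fun j => k (Th j) y)).
have [i ir] := mix_ratio_ge _ y sl.
apply: le_trans (le_bigmax 0 (fun j => (k (Th j) y / p y) `^ (a - 1)) i).
rewrite -[a - 1]opprB !powRN lef_pV2 ?posrE ?powR_gt0 ?mix_ratio_gt0 ?divr_gt0//.
by rewrite ge0_ler_powR// ?nnegrE ?subr_ge0 ltW// ?mix_ratio_gt0// divr_gt0.
Qed.

Let measurable_score l j :
  measurable_fun setT (fun y => k (Th j) y * mix_ratio l y `^ (a - 1)).
Proof.
apply: measurable_funM => //.
exact: (measurableT_comp (measurable_powR _) (measurable_mix_ratio l)).
Qed.

Lemma integrable_score l j : simplex l ->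
  nu.-integrable setT (EFin \o (fun y => k (Th j) y * mix_ratio l y `^ (a - 1))).
Proof.
move=> sl; apply: (le_integrabler _ _ dom) => // y.
exact: score_le_dom.
Qed.

(** A zero integral would make [k (Th j)] vanish almost everywhere, the power being positive,
    against its mass 1. *)
Lemma mix_score_gt0 l j : simplex l -> 0 < mix_score l j.
Proof.
move=> sl; rewrite lt_def andbC; apply/andP; split.
  by apply: Rintegral_ge0 => y _; case/andP: (score_le_dom _ j y sl).
apply/negP => /eqP Is0.
have : ae_eq nu setT (EFin \o k (Th j)) (cst 0%E).
  have := Rintegral_eq0_ae _ _ (integrable_score _ j sl)
    (fun y => proj1 (andP (score_le_dom _ j y sl))) Is0.
  apply: filterS => y /= /(_ I) [] /eqP.
  rewrite mulf_eq0 (gt_eqF (k0 _ _)) /= gt_eqF// powR_gt0//.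
  exact: mix_ratio_gt0.
move=> kae; have := k1 j.
rewrite (@ae_eq_integral _ _ _ nu setT (cst 0%E) (EFin \o k (Th j)))//; last first.
  exact/measurable_EFinP.
by rewrite integral_cst// mul0e => -[] /eqP; rewrite eq_sym oner_eq0.
Qed.

Lemma mix_score_bounded : exists M, forall l j, simplex l -> mix_score l j <= M.
Proof.
exists (\int[nu]_y dom y) => l j sl; apply: le_Rintegral => //.
  exact: integrable_score.
by move=> y _; case/andP: (score_le_dom _ j y sl).
Qed.

Lemma mix_score_continuous (u : nat -> 'I_J -> R) z :
  (forall n, simplex (u n)) -> simplex z ->
  (forall j, (fun n => u n j) @ \oo --> z j) ->
  forall j, (fun n => mix_score (u n) j) @ \oo --> mix_score z j.
Proof.
move=> su sz uz j; apply: fine_cvg.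
rewrite fineK; last by apply: integrable_fin_num => //; exact: integrable_score.
pose f n y := (k (Th j) y * mix_ratio (u n) y `^ (a - 1))%:E.
pose f0 y := (k (Th j) y * mix_ratio z y `^ (a - 1))%:E.
have [] := @dominated_convergence _ _ _ nu setT measurableT f f0 (EFin \o dom).
- by move=> n; exact/measurable_EFinP.
- exact/measurable_EFinP.
- apply: aeW => y _; apply: cvg_EFin; first by apply: nearW => n.
  apply: cvgM; first exact: cvg_cst.
  apply: powR_cvg; first exact: mix_ratio_gt0.
  apply: cvgM; last exact: cvg_cst.
  by apply: cvg_sum_ord => i; apply: cvgM; [exact: uz|exact: cvg_cst].
- exact: integrable_dom.
- apply: aeW => y n _; have /andP[s0 sd] := score_le_dom _ j y (su n).
  by rewrite gee0_abs ?lee_fin.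
- by move=> _ _.
Qed.

(** For a = 0 the integrand is at most w p + p max_j |ln (k_j / p)|. Otherwise w^a p = sum_j l_j k_j
    w^(a - 1) makes it a combination of score integrands, the mixture and p. *)
Lemma integrable_div l : simplex l ->
  nu.-integrable setT (EFin \o (fun y => falpha a (mix_ratio l y) * p y)).
Proof.
move=> sl; have [a0|a0] := eqVneq a 0.
- have iL : nu.-integrable setT (EFin \o
      (fun y => (\big[Num.max/0]_(j < J) `|ln (k (Th j) y / p y)|) * p y)).
    apply: ge0_integrable => //; last exact: ln_fin.
      apply: measurable_funM => //; apply: measurable_bigmax_fin => j.
      apply: measurableT_comp => //.
      exact: (measurableT_comp (@measurable_ln R) (measurable_density_ratio j)).
    by move=> y; rewrite mulr_ge0 ?bigmax_ge_id ?ltW.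
  apply: (le_integrabler _ _ _ _ _ (integrable_addr _ _ _ _ _ (integrable_mixk l) iL)) => //.
    apply: measurable_funM => //; rewrite a0 /falpha eqxx.
    apply: measurable_funB; last first.
      exact: (measurableT_comp (@measurable_ln R) (measurable_mix_ratio l)).
    by apply: measurable_funB => //; exact: measurable_mix_ratio.
  move=> y; have w0 := mix_ratio_gt0 _ y sl.
  apply/andP; split; first by rewrite mulr_ge0 ?falpha_ge0// ltW.
  rewrite /falpha a0 eqxx !mulrBl mix_ratioK.
  rewrite -addrA lerD2l mul1r -opprD lerNl.
  have [i ir] := mix_ratio_ge _ y sl.
  have h1 := le_bigmax 0 (fun j => `|ln (k (Th j) y / p y)|) i.
  have h2 : ln (k (Th i) y / p y) <= ln (mix_ratio l y).
    by rewrite ler_ln// posrE// divr_gt0.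
  have h3 := ler_norm (- ln (k (Th i) y / p y)); rewrite normrN in h3.
  set b := \big[_/_]_(_ < _) _ in h1 *.
  have : 0 <= (b + ln (mix_ratio l y)) * p y.
    by rewrite mulr_ge0 ?(ltW (p0 _))//; move: h1 h2 h3 => /=; lra.
  by rewrite mulrDl; have := p0 y; lra.
- have e y : falpha a (mix_ratio l y) * p y =
      (a * (a - 1))^-1 * (\sum_(j < J) l j * (k (Th j) y * mix_ratio l y `^ (a - 1)))
      - (a - 1)^-1 * (\sum_(j < J) l j * k (Th j) y) + a^-1 * p y.
    have w0 := mix_ratio_gt0 _ y sl.
    rewrite -/(mixk k Th l y) -mix_ratioK.
    under eq_bigr do rewrite mulrA.
    rewrite -mulr_suml -/(mixk k Th l y) -mix_ratioK.
    rewrite /falpha (negbTE a0) (lt_eqF a1) (powRB1 a)//; field.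
    by rewrite a0 subr_eq0 lt_eqF.
  under eq_fun do rewrite e.
  apply: integrable_addr => //; last exact/integrable_scaler/integrable_target.
  apply: integrable_subr => //; last exact/integrable_scaler/integrable_mixk.
  apply: integrable_scaler => //; apply: integrable_sumr => // j.
  exact/integrable_scaler/integrable_score.
Qed.

Lemma mix_divE l : simplex l -> Psi nu k p a Th l = (mix_div l)%:E.
Proof.
move=> sl; rewrite -[LHS]fineK//; apply: integrable_fin_num => //.
exact: integrable_div.
Qed.

Lemma mix_div_ge0 l : simplex l -> 0 <= mix_div l.
Proof.
move=> sl; apply: Rintegral_ge0 => y _.
by rewrite mulr_ge0 ?falpha_ge0 ?mix_ratio_gt0// ltW.
Qed.

Let bregman l z y : R :=
  mix_ratio z y `^ a * falpha a (mix_ratio l y / mix_ratio z y) * p y.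

Let bregman_ge0 l z y : simplex l -> simplex z -> 0 <= bregman l z y.
Proof.
move=> sl sz; rewrite /bregman mulr_ge0 ?(ltW (p0 _))// mulr_ge0 ?powR_ge0//.
by rewrite falpha_ge0// divr_gt0// mix_ratio_gt0.
Qed.

(** The derivative (w^(a - 1) - 1) / (a - 1) splits into a score part and a mass part; the latter
    integrates to zero, both weight vectors having sum 1. *)
Let bregmanE l z : simplex l -> simplex z -> bregman l z = fun y =>
  falpha a (mix_ratio l y) * p y - falpha a (mix_ratio z y) * p y
  - (a - 1)^-1 * (\sum_(j < J) (l j - z j) * (k (Th j) y * mix_ratio z y `^ (a - 1)))
  + (a - 1)^-1 * (\sum_(j < J) (l j - z j) * k (Th j) y).
Proof.
move=> sl sz; apply/funext => y.
have sE : \sum_(j < J) (l j - z j) * k (Th j) y =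
    (mix_ratio l y - mix_ratio z y) * p y.
  rewrite mulrBl !mix_ratioK -sumrB; apply: eq_bigr => j _; exact: mulrBl.
have tE : \sum_(j < J) (l j - z j) * (k (Th j) y * mix_ratio z y `^ (a - 1)) =
    (mix_ratio l y - mix_ratio z y) * p y * mix_ratio z y `^ (a - 1).
  by rewrite -sE mulr_suml; apply: eq_bigr => j _; rewrite mulrA.
rewrite sE tE (falpha_bregman a (mix_ratio z y) (mix_ratio l y))//;
  [|exact: mix_ratio_gt0|exact: mix_ratio_gt0].
by rewrite /bregman; field; rewrite subr_eq0 lt_eqF.
Qed.

Let integrable_wscore (c : 'I_J -> R) z : simplex z -> nu.-integrable setT (EFin \o
  (fun y => \sum_(j < J) c j * (k (Th j) y * mix_ratio z y `^ (a - 1)))).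
Proof.
move=> sz; apply: integrable_sumr => // j.
exact/integrable_scaler/integrable_score.
Qed.

Let Rintegral_wscore (c : 'I_J -> R) z : simplex z ->
  \int[nu]_y (\sum_(j < J) c j * (k (Th j) y * mix_ratio z y `^ (a - 1))) =
  \sum_(j < J) c j * mix_score z j.
Proof.
by move=> sz; rewrite Rintegral_sumr// => j; exact: integrable_score.
Qed.

Let integrable_bregman l z : simplex l -> simplex z ->
  nu.-integrable setT (EFin \o bregman l z).
Proof.
move=> sl sz; rewrite bregmanE//.
apply: integrable_addr => //; last exact/integrable_scaler/integrable_mixk.
apply: integrable_subr => //; last exact/integrable_scaler/integrable_wscore.
by apply: integrable_subr => //; exact: integrable_div.
Qed.

Let Rintegral_bregman l z : simplex l -> simplex z ->
  \int[nu]_y bregman l z y =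
  mix_div l - mix_div z - (\sum_(j < J) (l j - z j) * mix_score z j) / (a - 1).
Proof.
move=> sl sz; rewrite bregmanE//.
have i1 := integrable_subr _ _ _ _ measurableT (integrable_div _ sl) (integrable_div _ sz).
have i2 := integrable_scaler _ _ (a - 1)^-1 _ measurableT
  (integrable_wscore (fun j => l j - z j) _ sz).
have i3 := integrable_scaler _ _ (a - 1)^-1 _ measurableT
  (integrable_mixk (fun j => l j - z j)).
have i12 := integrable_subr _ _ _ _ measurableT i1 i2.
rewrite RintegralD// RintegralB// RintegralB//; [|exact: integrable_div..].
rewrite !RintegralZl//; [|exact: integrable_mixk|exact: integrable_wscore].
by rewrite Rintegral_wscore// Rintegral_mixk sumrB sl.2 sz.2 subrr mulr0 addr0 mulrC.
Qed.

Lemma mix_div_tangent l z : simplex l -> simplex z ->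
  mix_div z + (\sum_(j < J) (l j - z j) * mix_score z j) / (a - 1) <= mix_div l.
Proof.
move=> sl sz; have : 0 <= \int[nu]_y bregman l z y.
  by apply: Rintegral_ge0 => y _; exact: bregman_ge0.
by rewrite Rintegral_bregman//; lra.
Qed.

(** Equality forces the Bregman term to vanish almost everywhere, so the two mixtures agree almost
    everywhere and the measures combined with coefficients l_j - z_j give zero. *)
Lemma mix_div_tangent_lt l z : lin_indep_measures nu k Th ->
  simplex l -> simplex z -> l != z ->
  mix_div z + (\sum_(j < J) (l j - z j) * mix_score z j) / (a - 1) < mix_div l.
Proof.
move=> indep sl sz lz; rewrite lt_neqAle mix_div_tangent// andbT.
apply: contra lz => /eqP e; apply/eqP/funext => j.
apply/eqP; rewrite -subr_eq0; apply/eqP; move: j.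
have I0 : \int[nu]_y bregman l z y = 0 by rewrite Rintegral_bregman//; lra.
have ae0 : ae_eq nu setT
    (EFin \o (fun y => \sum_(j < J) (l j - z j) * k (Th j) y)) (cst 0%E).
  have := Rintegral_eq0_ae _ _ (integrable_bregman _ _ sl sz)
    (fun y => bregman_ge0 _ _ y sl sz) I0.
  apply: filterS => y /= /(_ I) [] /eqP.
  have [wl wz] := (mix_ratio_gt0 _ y sl, mix_ratio_gt0 _ y sz).
  rewrite /bregman !mulf_eq0 (gt_eqF (p0 _)) orbF gt_eqF ?powR_gt0//= => f0 _.
  have /eqP : mix_ratio l y / mix_ratio z y == 1.
    by apply: contraTT f0 => ne1; rewrite gt_eqF// falpha_gt0// divr_gt0.
  move=> /divr1_eq h; congr EFin.
  under eq_bigr do rewrite mulrBl.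
  by rewrite sumrB -/(mixk k Th l y) -/(mixk k Th z y) -!mix_ratioK h subrr.
apply: (indep (fun j => l j - z j)) => A mA.
have kA j : nu.-integrable A (EFin \o k (Th j)).
  by apply: integrableS (integrable_density j).
have KE j : Kmeas nu k (Th j) A = (\int[nu]_(y in A) k (Th j) y)%:E.
  by rewrite /Rintegral fineK//; exact: (integrable_fin_num mA (kA j)).
under eq_bigr do rewrite KE -EFinM.
rewrite sumEFin -Rintegral_sumr//; congr EFin.
rewrite /Rintegral (@ae_eq_integral _ _ _ nu A (cst 0%E)
  (EFin \o (fun y => \sum_(j < J) (l j - z j) * k (Th j) y)))//.
- by rewrite integral_cst// mul0e.
- apply: (@measurable_funS _ _ _ _ setT) => //.
  exact: measurable_int (integrable_mixk _).
- by apply: filterS ae0 => y h _; exact: h.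
Qed.

(* Jensen's inequality for halpha under the posterior weights
   l j * k (Th j) y / mixk k Th l y, whose mean of g is the ratio of the two
   mixtures. *)
Let falpha_scale l (g : 'I_J -> R) y : simplex l ->
  simplex (fun j => l j * g j) -> (forall j, 0 < g j) ->
  falpha a (mix_ratio (fun j => l j * g j) y) * p y <=
  falpha a (mix_ratio l y) * p y
  + \sum_(j < J) l j * halpha a (g j) * (k (Th j) y * mix_ratio l y `^ (a - 1))
  - (a - 1)^-1 * (\sum_(j < J) (l j * g j - l j) * k (Th j) y).
Proof.
move=> sl slg g0; set l' := fun j => l j * g j.
have [w0 w'0] := (mix_ratio_gt0 _ y sl, mix_ratio_gt0 _ y slg).
rewrite -/l' in w'0 *; set w := mix_ratio l y in w0 *; set w' := mix_ratio l' y in w'0 *.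
set t := w' / w; have t0 : 0 < t by rewrite divr_gt0.
have w'E : w' = t * w by rewrite divfK// gt_eqF.
have sE : \sum_(j < J) (l j * g j - l j) * k (Th j) y = (w' - w) * p y.
  rewrite mulrBl !mix_ratioK -sumrB; apply: eq_bigr => j _; exact: mulrBl.
have jensen : w `^ a * halpha a t * p y <=
    \sum_(j < J) l j * halpha a (g j) * (k (Th j) y * w `^ (a - 1)).
  apply: le_trans (_ : \sum_(j < J) (l j * (k (Th j) y * w `^ (a - 1))) *
      (halpha a t + t `^ (a - 1) / (a - 1) * (g j - t)) <= _); last first.
    apply: ler_sum => j _; rewrite [leRHS]mulrAC ler_wpM2l//.
      by rewrite !mulr_ge0 ?powR_ge0 ?sl.1// ltW.
    exact: halpha_tangent.
  rewrite (eq_bigr (fun j => (halpha a t - t `^ (a - 1) / (a - 1) * t) * w `^ (a - 1) *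
      (l j * k (Th j) y) + t `^ (a - 1) / (a - 1) * w `^ (a - 1) *
      (l' j * k (Th j) y))); last by move=> j _; rewrite /l'; ring.
  rewrite big_split/= -!mulr_sumr -/(mixk k Th l y) -/(mixk k Th l' y).
  rewrite -!mix_ratioK -/w -/w' w'E (powRB1 a w)//.
  by rewrite le_eqVlt; apply/orP; left; apply/eqP; ring.
rewrite sE {1}w'E falphaM// -w'E; move: jensen; rewrite !mulrDl mulNr.
by set S := \sum_(j < J) _ => jensen; lra.
Qed.

(** Integrates the pointwise bound; its last term drops since both weight vectors have sum 1. *)
Lemma mix_div_scale l (g : 'I_J -> R) : simplex l -> (forall j, 0 < g j) ->
  \sum_(j < J) l j * g j = 1 ->
  mix_div (fun j => l j * g j) <=
  mix_div l + \sum_(j < J) l j * mix_score l j * halpha a (g j).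
Proof.
move=> sl g0 lg1.
have slg : simplex (fun j => l j * g j).
  by split => // j; rewrite mulr_ge0 ?sl.1// ltW.
have i1 := integrable_div _ sl.
have i2 := integrable_wscore (fun j => l j * halpha a (g j)) _ sl.
have i3 := integrable_scaler _ _ (a - 1)^-1 _ measurableT
  (integrable_mixk (fun j => l j * g j - l j)).
have i12 := integrable_addr _ _ _ _ measurableT i1 i2.
have := le_Rintegral measurableT (integrable_div _ slg)
  (integrable_subr _ _ _ _ measurableT i12 i3) (fun y _ => falpha_scale _ _ y sl slg g0).
rewrite RintegralB// RintegralD// RintegralZl//; last exact: integrable_mixk.
rewrite Rintegral_wscore// Rintegral_mixk sumrB lg1 sl.2 subrr mulr0 subr0.
by under [X in _ + X]eq_bigr do rewrite mulrAC.
Qed.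

Let b_integrandE l j y : b_integrand k p a Th l (Th j) y =
  (a - 1)^-1 * (k (Th j) y * mix_ratio l y `^ (a - 1) - k (Th j) y).
Proof. by rewrite /b_integrand /dfalpha -/(mix_ratio l y); ring. Qed.

Lemma integrable_b_integrand l j : simplex l ->
  nu.-integrable setT (fun y => (b_integrand k p a Th l (Th j) y)%:E).
Proof.
move=> sl; under eq_fun do rewrite b_integrandE.
apply: integrable_scaler => //; apply: integrable_subr => //.
  exact: integrable_score.
exact: integrable_density.
Qed.

(** The added 1 offsets the constant in [dfalpha], since [k (Th j)] has mass 1. *)
Lemma bmu_mix_score l j : simplex l ->
  (a - 1) * bmu nu k p a Th l (Th j) + 1 = mix_score l j.
Proof.
move=> sl; have [iS iK] := (integrable_score _ j sl, integrable_density j).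
rewrite /bmu (funext (b_integrandE l j)).
rewrite RintegralZl//; last exact: integrable_subr.
rewrite RintegralB// Rintegral_density mulVKf ?subrK//.
by rewrite subr_eq0 lt_eqF.
Qed.

Lemma Gamma_mix_score (eta kappa : R) l j : simplex l ->
  Gamma_alpha a eta (bmu nu k p a Th l (Th j) + kappa) =
  (mix_score l j + (a - 1) * kappa) `^ (eta / (1 - a)).
Proof. by move=> sl; rewrite -bmu_mix_score// /Gamma_alpha mulrDr addrAC. Qed.

Lemma norm_sum_power_mass (eta kappa : R) l : simplex l ->
  norm_sum nu k p a eta kappa Th l =
  power_mass a eta ((a - 1) * kappa) mix_score l.
Proof. by move=> sl; apply: eq_bigr => j _; rewrite Gamma_mix_score. Qed.

Lemma Imixt_power_update (eta kappa : R) l : simplex l ->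
  Imixt nu k p a eta kappa Th l =
  power_update a eta ((a - 1) * kappa) mix_score l.
Proof.
move=> sl; apply/funext => j.
by rewrite /Imixt norm_sum_power_mass// Gamma_mix_score.
Qed.

End mixture_divergence.

(** * Specialisation of the abstract convergence result to mixture weights *)

Theorem theorem2 (R : realType) (d : measure_display) (Y : measurableType d)
  (nu : {measure set Y -> \bar R}) (T : pseudoMetricType R)
  (k : T -> Y -> R) (p : Y -> R) (a : R) (J : nat) (Th : 'I_J -> T)
  (kappa : R) :
  (* standing assumptions *)
  sigma_finite setT nu ->
  jointly_measurable k ->
  (forall th, (\int[nu]_y (k th y)%:E = 1)%E) ->
  measurable_fun setT p ->
  (* (A1) *)
  (forall th y, 0 < k th y) ->
  (forall y, 0 < p y) ->
  (\int[nu]_y (p y)%:E < +oo)%E ->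
  (* (A3)(i) *)
  (forall y, continuous (fun th => k th y)) ->
  (* (A3)(ii) *)
  (\int[nu]_y ((\big[Num.max/0]_(j < J) k (Th j) y)
       * (\big[Num.max/0]_(j' < J) (k (Th j') y / p y) `^ (a - 1)))%:E < +oo)%E ->
  (a = 0 ->
     (\int[nu]_y ((\big[Num.max/0]_(j < J) `|ln (k (Th j) y / p y)|) * p y)%:E
        < +oo)%E) ->
  a < 1 -> kappa <= 0 ->
  (forall lam, simplex lam -> (Psi nu k p a Th lam < +oo)%E) /\
  (forall eta, 0 < eta ->
   forall lams : nat -> 'I_J -> R,
     simplex (lams 0%N) ->
     (forall n, lams n.+1 = Imixt nu k p a eta kappa Th (lams n)) ->
     (* well-definedness *)
     (forall n,
        (forall j, nu.-integrable setT
                     (fun y => (b_integrand k p a Th (lams n) (Th j) y)%:E)) /\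
        (forall j, 0 < (a - 1) * (bmu nu k p a Th (lams n) (Th j) + kappa) + 1) /\
        0 < norm_sum nu k p a eta kappa Th (lams n)) /\
     (simplex_pos (lams 0%N) -> eta <= 1 -> lin_indep_measures nu k Th ->
       (* (i) *)
       (forall n, (Psi nu k p a Th (lams n.+1) <= Psi nu k p a Th (lams n))%E) /\
       (* (ii) and (iii) *)
       exists lstar : 'I_J -> R,
         simplex lstar /\
         (forall j, (fun n => lams n j) @ \oo --> lstar j) /\
         Imixt nu k p a eta kappa Th lstar = lstar /\
         Psi nu k p a Th lstar
           = ereal_inf [set Psi nu k p a Th l | l in simplex (J := J)])).
Proof.
move=> _ jm k1T mp k0T p0 p_fin _ dom_fin ln_fin a1 kappa0.
have mk j : measurable_fun setT (k (Th j)) by exact: jointly_measurable_section.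
have k1 j := k1T (Th j).
have k0 j y := k0T (Th j) y.
pose G := mix_score nu k p a Th.
pose F := mix_div nu k p a Th.
have c0 : 0 <= (a - 1) * kappa by rewrite mulr_le0// subr_le0 ltW.
have G0 l : simplex l -> forall j, 0 < G l j.
  by move=> sl j; exact: mix_score_gt0.
have PsiE l : simplex l -> Psi nu k p a Th l = (F l)%:E.
  by move=> sl; exact: mix_divE.
split=> [l sl|eta eta0 lams s0 lamsS]; first by rewrite PsiE// ltry.
(* Membership is propagated first: the simplex is where [Imixt] is identified with
   [power_update]. *)
have lamsP n : simplex (lams n).
  elim: n => // n ih; rewrite lamsS (Imixt_power_update nu k p a Th)//.
  exact: power_update_simplex.
have lamsE n : lams n.+1 = power_update a eta ((a - 1) * kappa) G (lams n).
  by rewrite lamsS (Imixt_power_update nu k p a Th).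
split=> [n|lam0 eta1 indep].
  split=> [j|]; first exact: integrable_b_integrand.
  split=> [j|].
    by rewrite mulrDr addrAC (bmu_mix_score nu k p a Th)// ltr_wpDr// G0.
  rewrite (norm_sum_power_mass nu k p a Th)//; exact: power_mass_gt0.
have scale := mix_div_scale nu k p a Th a1 mk k1 mp k0 p0 p_fin dom_fin ln_fin.
split=> [n|].
  by rewrite !PsiE// lee_fin lamsE; exact: (power_update_descent _ _ _ F).
have [z [sz cz fz oz]] : exists z, [/\ simplex z,
    forall j, (fun n => lams n j) @ \oo --> z j,
    power_update a eta ((a - 1) * kappa) G z = z
    & forall l, simplex l -> F z <= F l].
  apply: power_descent_cvg => //.
  - exact: mix_score_bounded.
  - by move=> u z su sz uz j; exact: mix_score_continuous.
  - by move=> l sl; exact: mix_div_ge0.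
  - by move=> l z sl sz; exact: mix_div_tangent.
  - by move=> l z sl sz lz; exact: mix_div_tangent_lt.
exists z; split => //; split => //; split.
  by rewrite (Imixt_power_update nu k p a Th).
apply/eqP; rewrite eq_le; apply/andP; split.
  by apply: le_ereal_inf_tmp => _ [l sl <-]; rewrite !PsiE// lee_fin oz.
by apply: ereal_inf_lbound; exists z.
Qed.
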